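(* Let $\mathcal{L}$ be a Lindbladian on density operators on $\mathbb{C}^d$ with a unique steady state $\sigma$, i.e. $\{\rho : \mathcal{L}(\rho)=0\}=\{\sigma\}$. If $\sigma$ has an eigenvalue $\lambda<1/d^2$, then $\gamma(\mathcal{L})>0$.
   Context: A Lindbladian has GKSL form and generates the CPTP semigroup $(e^{t\mathcal{L}})_{t\ge0}$. For a program space $\mathcal{H}_P$, program states $(\pi_t)_{t\ge0}$ on $\mathcal{H}_P$ and $T\ge0$, the exact programming cost is $\gamma(\pi_t,\mathcal{L},T)=\log_2\min\{\|\mathcal{P}\|_\diamond : \mathcal{P}$ Hermitian-preserving trace-preserving linear map from operators on $\mathbb{C}^d\otimes\mathcal{H}_P$ to operators on $\mathbb{C}^d$ with $\mathcal{P}(\cdot\otimes\pi_t)=e^{t\mathcal{L}}$ for all $t\in[0,T]\}$ (the minimum over an empty set being $+\infty$), where $\|\cdot\|_\diamond$ is the diamond norm, and $\gamma(\pi_t,\mathcal{L})=\lim_{T\to\infty}\gamma(\pi_t,\mathcal{L},T)$. The quantity $\gamma(\mathcal{L})$ denotes $\gamma(\pi_t,\mathcal{L})$ for the Choi-state program states $\pi_t=J(e^{t\mathcal{L}})/d$ on $\mathcal{H}_P=\mathbb{C}^d\otimes\mathbb{C}^d$, where $J(\mathcal{N})=\sum_{i,j=0}^{d-1}|i\rangle\langle j|\otimes\mathcal{N}(|i\rangle\langle j|)$. *)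

(* Defs.v *)
From HB Require Import structures.
From mathcomp Require Import all_boot all_order all_algebra.
From mathcomp Require Import all_classical all_reals all_analysis.
From mathcomp Require Import complex mxtens.

Set Implicit Arguments.
Unset Strict Implicit.
Unset Printing Implicit Defensive.

Import Order.TTheory GRing.Theory Num.Theory.
Import numFieldNormedType.Exports.

Local Open Scope ring_scope.
Local Open Scope classical_set_scope.

Section QuantumDefs.

Variable R : realType.
Local Notation C := (R[i]).

Definition adjmx (m n : nat) (A : 'M[C]_(m, n)) : 'M[C]_(n, m) :=
  \matrix_(i, j) (A j i)^*.

Definition is_hermitian (n : nat) (A : 'M[C]_n) : Prop := adjmx A = A.

Definition psd (n : nat) (A : 'M[C]_n) : Prop :=
  is_hermitian A /\ forall v : 'cV[C]_n, 0 <= (adjmx v *m A *m v) 0 0.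

Definition is_density (n : nat) (rho : 'M[C]_n) : Prop := psd rho /\ \tr rho = 1.

Definition is_linear_map (n m : nat) (f : 'M[C]_n -> 'M[C]_m) : Prop :=
  forall (a : C) (x y : 'M[C]_n), f (a *: x + y) = a *: f x + f y.

Definition herm_preserving (n m : nat) (f : 'M[C]_n -> 'M[C]_m) : Prop :=
  forall x : 'M[C]_n, f (adjmx x) = adjmx (f x).

Definition trace_preserving (n m : nat) (f : 'M[C]_n -> 'M[C]_m) : Prop :=
  forall x : 'M[C]_n, \tr (f x) = \tr x.

(* trace norm ||X||_1 = sum of the singular values of X, i.e. of the square
   roots of the eigenvalues (with multiplicity) of X^dagger X.  The set below
   is a singleton (the eigenvalue multiset is determined by char_poly), so the
   sup is its unique element. *)
Definition trace_norm (n : nat) (X : 'M[C]_n) : R :=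
  sup [set r : R | exists s : 'I_n -> R,
         (forall i, 0 <= s i) /\
         char_poly (adjmx X *m X) = \prod_(i < n) ('X - (Complex (s i) 0)%:P) /\
         r = \sum_(i < n) Num.sqrt (s i)].

(* (f \otimes id_k)(X) for X an operator on C^n \otimes C^k (ancilla on the
   right, Kronecker index convention of mxtens: (i,p) |-> mxtens_index (i,p)) *)
Definition tens_id (n m k : nat) (f : 'M[C]_n -> 'M[C]_m) (X : 'M[C]_(n * k))
  : 'M[C]_(m * k) :=
  \matrix_(a, b)
    f (\matrix_(i, j) X (mxtens_index (i, (mxtens_unindex a).2))
                        (mxtens_index (j, (mxtens_unindex b).2)))
      (mxtens_unindex a).1 (mxtens_unindex b).1.

Definition diamond_norm (n m : nat) (f : 'M[C]_n -> 'M[C]_m) : R :=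
  sup [set r : R | exists X : 'M[C]_(n * n),
         trace_norm X <= 1 /\ r = trace_norm (tens_id f X)].

Definition expmx_partial (n : nat) (A : 'M[C]_n) (N : nat) : 'M[C]_n :=
  \sum_(k < N) (k`!%:R)^-1 *: A ^+ k.

Definition expmx (n : nat) (A : 'M[C]_n) : 'M[C]_n :=
  \matrix_(i, j)
    Complex (lim ((fun N => complex.Re (expmx_partial A N i j)) @ \oo))
            (lim ((fun N => complex.Im (expmx_partial A N i j)) @ \oo)).

Definition gksl (d m : nat) (H : 'M[C]_d) (Ls : 'I_m -> 'M[C]_d)
  (rho : 'M[C]_d) : 'M[C]_d :=
  - 'i *: (H *m rho - rho *m H) +
  \sum_(k < m) (Ls k *m rho *m adjmx (Ls k)
                - 2^-1 *: (adjmx (Ls k) *m Ls k *m rho + rho *m adjmx (Ls k) *m Ls k)).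

Definition semigroup (d : nat) (L : 'M[C]_d -> 'M[C]_d) (t : R)
  (X : 'M[C]_d) : 'M[C]_d :=
  vec_mx (mxvec X *m expmx (Complex t 0 *: lin_mx L)).

Definition choi (d : nat) (N : 'M[C]_d -> 'M[C]_d) : 'M[C]_(d * d) :=
  \sum_(i < d) \sum_(j < d) (delta_mx i j *t N (delta_mx i j)).

Definition choi_program (d : nat) (L : 'M[C]_d -> 'M[C]_d) (t : R)
  : 'M[C]_(d * d) :=
  (d%:R)^-1 *: choi (semigroup L t).

Definition admissible_norms (d p : nat) (pi : R -> 'M[C]_p)
  (L : 'M[C]_d -> 'M[C]_d) (T : R) : set R :=
  [set r : R | exists P : 'M[C]_(d * p) -> 'M[C]_d,
     is_linear_map P /\ herm_preserving P /\ trace_preserving P /\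
     (forall t : R, 0 <= t <= T -> forall X : 'M[C]_d, P (X *t pi t) = semigroup L t X) /\
     r = diamond_norm P].

Definition log2 (x : R) : R := ln x / ln 2.

(* gamma(pi_t, L, T) = log2 min {...}; the infimum over the empty set is +oo *)
Definition prog_cost_T (d p : nat) (pi : R -> 'M[C]_p)
  (L : 'M[C]_d -> 'M[C]_d) (T : R) : \bar R :=
  ereal_inf [set (log2 r)%:E | r in admissible_norms pi L T].

Definition prog_cost (d p : nat) (pi : R -> 'M[C]_p)
  (L : 'M[C]_d -> 'M[C]_d) : \bar R :=
  lim (prog_cost_T pi L T @[T --> +oo%R]).

Definition gammaL (d : nat) (L : 'M[C]_d -> 'M[C]_d) : \bar R :=
  prog_cost (choi_program L) L.

End QuantumDefs.

(* Main.v *)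
(** Write [Phi] for the maximally entangled state, [omega = 1 (x) sigma / d] and
    [psi] for the projection on an eigenvector of [sigma] for [lambda]. A map [P]
    that programs [exp (t L)] on [[0, T]], [T > 0], satisfies [P (X (x) Phi) = X]
    (take [t = 0]) and [P (X (x) omega) = tr X sigma]: the power series in [t] give
    the programming identity for every power of [L], hence for the multiple of the
    spectral projection on [ker L] which is a polynomial in [L]. So [P] sends
    [psi (x) (omega - k Phi)], of trace norm at most [1 + k - 2 / d^2 + O(1 / k)],
    to [sigma - k psi], of trace norm at least [1 + k - 2 lambda]. For [k] large
    this bounds the diamond norm of [P] below by a constant larger than [1] which
    depends neither on [P] nor on [T]. *)
Require Import Defs.
From HB Require Import structures.
From mathcomp Require Import all_boot all_order all_algebra.
From mathcomp Require Import all_classical all_reals all_analysis.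
From mathcomp Require Import complex mxtens.
From mathcomp Require Import spectral sesquilinear ring lra.
Import Order.TTheory GRing.Theory Num.Theory.
Import numFieldNormedType.Exports.
Local Open Scope ring_scope.

Set Implicit Arguments.
Unset Strict Implicit.
Unset Printing Implicit Defensive.

(** * Hermitian and positive semidefinite matrices, and the trace norm *)

Section HermitianMatrices.
Variable R : realType.
Local Notation C := R[i].

Lemma adjmxE m n (A : 'M[C]_(m, n)) : adjmx A = map_mx Num.conj A^T.
Proof. by apply/matrixP => i j; rewrite !mxE. Qed.

Lemma adjmxK m n (A : 'M[C]_(m, n)) : adjmx (adjmx A) = A.
Proof. by apply/matrixP => i j; rewrite !mxE conjCK. Qed.

Lemma adjmxM m n p (A : 'M[C]_(m, n)) (B : 'M[C]_(n, p)) :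
  adjmx (A *m B) = adjmx B *m adjmx A.
Proof. by rewrite !adjmxE trmx_mul map_mxM. Qed.

Lemma adjmxD m n (A B : 'M[C]_(m, n)) : adjmx (A + B) = adjmx A + adjmx B.
Proof. by apply/matrixP => i j; rewrite !mxE rmorphD. Qed.

Lemma adjmxB m n (A B : 'M[C]_(m, n)) : adjmx (A - B) = adjmx A - adjmx B.
Proof. by apply/matrixP => i j; rewrite !mxE rmorphB. Qed.

Lemma adjmxZ m n a (A : 'M[C]_(m, n)) : adjmx (a *: A) = a^* *: adjmx A.
Proof. by apply/matrixP => i j; rewrite !mxE rmorphM. Qed.

Lemma adjmx_sum m n I (r : seq I) (F : I -> 'M[C]_(m, n)) :
  adjmx (\sum_(i <- r) F i) = \sum_(i <- r) adjmx (F i).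
Proof.
elim/big_rec2: _ => [|i A B _ <-]; last by rewrite adjmxD.
by apply/matrixP => i j; rewrite !mxE conjC0.
Qed.

Lemma adjmx1 n : adjmx (1%:M : 'M[C]_n) = 1%:M.
Proof. by rewrite adjmxE trmx1 map_mx1. Qed.

Lemma adjmx_tens m n p q (A : 'M[C]_(m, n)) (B : 'M[C]_(p, q)) :
  adjmx (A *t B) = adjmx A *t adjmx B.
Proof. by rewrite !adjmxE trmx_tens map_mxT. Qed.

Lemma conjC_realc (x : R) : (x%:C%C : C)^* = x%:C%C.
Proof. by apply/CrealP; rewrite complex_real. Qed.

Lemma mxtrace_adj_mul m n (A : 'M[C]_(m, n)) :
  \tr (adjmx A *m A) = \sum_i \sum_j `|A j i| ^+ 2.
Proof.
apply: eq_bigr => i _; rewrite mxE; apply: eq_bigr => j _.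
by rewrite !mxE normCK mulrC.
Qed.

Lemma mxtrace_tens n p (A : 'M[C]_n) (B : 'M[C]_p) :
  \tr (A *t B) = \tr A * \tr B.
Proof.
rewrite /mxtrace mulr_sum; apply: eq_bigr => k _.
by rewrite mxE.
Qed.

Lemma hermitian_spectral n (A : 'M[C]_n) : is_hermitian A ->
  exists U : 'M[C]_n, exists x : 'I_n -> R,
    [/\ adjmx U *m U = 1%:M, U *m adjmx U = 1%:M &
        A = U *m diag_mx (\row_i (x i)%:C%C) *m adjmx U].
Proof.
rewrite /is_hermitian adjmxE => hA.
have herm : A \is hermsymmx.
  by apply/is_hermitianmxP; rewrite expr0 scale1r /= hA.
have /orthomx_spectralP eqA := hermitian_normalmx herm.
have Uu := spectral_unitarymx A.
have Uin := spectral_unit A.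
have realD := hermitian_spectral_diag_real herm.
set U := spectralmx A in eqA Uu Uin.
have Uinv : invmx U = adjmx U by rewrite invmx_unitary // adjmxE.
(* In [eqA] the matrix [spectralmx A] stands to the right of the diagonal, so its adjoint is the
   witness. *)
exists (adjmx U), (fun i => complex.Re (spectral_diag A 0 i)).
rewrite adjmxK -Uinv mulmxV // mulVmx //; split => //.
suff -> : (\row_i (complex.Re (spectral_diag A 0 i))%:C%C) = spectral_diag A.
  exact: eqA.
apply/rowP => i; rewrite mxE RRe_real //.
exact: (mxOverP realD).
Qed.

Lemma char_poly_conj n (U V A : 'M[C]_n) : U *m V = 1%:M ->
  char_poly (U *m A *m V) = char_poly A.
Proof.
move=> UV; rewrite /char_poly.
have detUV : \det (map_mx polyC U) * \det (map_mx polyC V) = 1 :> {poly C}.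
  by rewrite -det_mulmx -map_mxM UV map_mx1 det1.
have -> : char_poly_mx (U *m A *m V) =
    map_mx polyC U *m char_poly_mx A *m map_mx polyC V.
  rewrite /char_poly_mx mulmxBr mulmxBl !map_mxM; congr (_ - _).
  by rewrite scalar_mxC -mulmxA -map_mxM UV map_mx1 mulmx1.
by rewrite !det_mulmx mulrAC detUV mul1r.
Qed.

Lemma char_poly_diag_mx n (x : 'I_n -> R) :
  char_poly (diag_mx (\row_i (x i)%:C%C)) =
  \prod_(i < n) ('X - ((x i)%:C%C : C)%:P).
Proof.
rewrite char_poly_trig; last exact/diag_mx_is_trig.
by apply: eq_bigr => i _; rewrite !mxE eqxx.
Qed.

(** By unique factorisation the product determines the family [s] up to order, so any such family
    computes the norm. *)
Lemma trace_normE n (X : 'M[C]_n) (s : 'I_n -> R) : (forall i, 0 <= s i) ->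
  char_poly (adjmx X *m X) = \prod_(i < n) ('X - ((s i)%:C%C)%:P) ->
  trace_norm X = \sum_i Num.sqrt (s i).
Proof.
move=> s0 cs; rewrite /trace_norm; set A := (X in sup X).
suff -> : A = [set \sum_i Num.sqrt (s i)]%classic by rewrite sup1.
apply/seteqP; split => [r [s' [s'0 [cs' ->]]]|r ->] /=; last by exists s.
set t' := [seq (s' i)%:C%C : C | i <- index_enum 'I_n].
set t := [seq (s i)%:C%C : C | i <- index_enum 'I_n].
have e : perm_eq t' t by apply: prod_XsubC_eq; rewrite !big_map -cs -cs'.
have : \sum_(z <- t') Num.sqrt (complex.Re z) = \sum_(z <- t) Num.sqrt (complex.Re z).
  exact: perm_big.
by rewrite !big_map.
Qed.

Lemma psd_gram m n (A : 'M[C]_(m, n)) : psd (A *m adjmx A).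
Proof.
split=> [|v]; first by rewrite /is_hermitian adjmxM adjmxK.
rewrite mulmxA -mulmxA -[X in _ *m X]adjmxK adjmxM adjmxK.
rewrite mxE sumr_ge0 // => i _.
by rewrite [X in _ * X]mxE mul_conjC_ge0.
Qed.

Lemma psd_conj m n (K : 'M[C]_(m, n)) (A : 'M[C]_n) :
  psd A -> psd (K *m A *m adjmx K).
Proof.
case=> hA pA; split=> [|v]; first by rewrite /is_hermitian !adjmxM adjmxK hA mulmxA.
by have := pA (adjmx K *m v); rewrite adjmxM adjmxK !mulmxA.
Qed.

Lemma psd_diag_ge0 n (A : 'M[C]_n) i : psd A -> 0 <= A i i.
Proof.
case=> _ /(_ (delta_mx i 0)); rewrite -mulmxA -colE.
rewrite (_ : adjmx _ = delta_mx 0 i) -?rowE ?mxE //.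
by apply/matrixP => a b; rewrite !mxE andbC; case: andb; rewrite ?conjC0 ?conjC1.
Qed.

Lemma psd_trace_ge0 n (A : 'M[C]_n) : psd A -> 0 <= \tr A.
Proof. by move=> pA; apply: sumr_ge0 => i _; apply: psd_diag_ge0. Qed.

Lemma diag_mx_sqrt n (x : 'I_n -> R) (D := fun y : 'I_n -> R =>
    diag_mx (\row_i (y i)%:C%C : 'rV[C]_n)) : (forall i, 0 <= x i) ->
  D x = D (Num.sqrt \o x) *m adjmx (D (Num.sqrt \o x)).
Proof.
move=> x0; apply/matrixP => i j; rewrite !mxE (bigD1 i) //= big1 ?addr0 => [|k ki].
  rewrite !mxE eqxx eq_sym; case: eqVneq => [->|ij]; last first.
    by rewrite !mulr0n conjC0 mulr0.
  by rewrite !mulr1n conjC_realc -rmorphM /= -expr2 sqr_sqrtr.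
by rewrite !mxE eq_sym (negPf ki) mulr0n mul0r.
Qed.

Lemma psd_diag_mx n (x : 'I_n -> R) : (forall i, 0 <= x i) ->
  psd (diag_mx (\row_i (x i)%:C%C : 'rV[C]_n)).
Proof. by move=> /diag_mx_sqrt ->; apply: psd_gram. Qed.

Lemma psd_eigen_ge0 n (U : 'M[C]_n) (x : 'I_n -> R) i : adjmx U *m U = 1%:M ->
  psd (U *m diag_mx (\row_i (x i)%:C%C) *m adjmx U) -> 0 <= x i.
Proof.
move=> UU' pA; have := psd_diag_ge0 i (psd_conj (adjmx U) pA).
rewrite adjmxK !mulmxA UU' mul1mx -mulmxA UU' mulmx1 !mxE eqxx mulr1n.
by rewrite ler0c.
Qed.

Lemma psd_sqrt n (A : 'M[C]_n) : psd A -> exists S : 'M[C]_n, A = S *m adjmx S.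
Proof.
move=> pA; have [U [x [UU' _ eA]]] := hermitian_spectral pA.1.
rewrite eA in pA *; have x0 i := psd_eigen_ge0 i UU' pA.
exists (U *m diag_mx (\row_i (Num.sqrt (x i))%:C%C)).
by rewrite (diag_mx_sqrt x0) adjmxM !mulmxA.
Qed.

Lemma psd_tens n p (A : 'M[C]_n) (B : 'M[C]_p) : psd A -> psd B -> psd (A *t B).
Proof.
move=> /psd_sqrt[S ->] /psd_sqrt[T ->].
by rewrite -tensmx_mul -adjmx_tens; apply: psd_gram.
Qed.

Lemma psdD n (A B : 'M[C]_n) : psd A -> psd B -> psd (A + B).
Proof.
move=> [hA pA] [hB pB]; split=> [|v]; first by rewrite /is_hermitian adjmxD hA hB.
by rewrite mulmxDr mulmxDl mxE addr_ge0.
Qed.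

Lemma psdZ n (a : C) (A : 'M[C]_n) : 0 <= a -> psd A -> psd (a *: A).
Proof.
move=> a0 [hA pA]; split=> [|v].
  by rewrite /is_hermitian adjmxZ hA (CrealP _) // ger0_real.
by rewrite -scalemxAr -scalemxAl mxE mulr_ge0.
Qed.

Lemma char_poly_gram n (X : 'M[C]_n) : exists s : 'I_n -> R,
  [/\ forall i, 0 <= s i,
    char_poly (adjmx X *m X) = \prod_(i < n) ('X - ((s i)%:C%C)%:P) &
    \tr (adjmx X *m X) = (\sum_i s i)%:C%C].
Proof.
have pA := psd_gram (adjmx X); rewrite adjmxK in pA.
have [U [x [UU' U'U eA]]] := hermitian_spectral pA.1.
exists x; split.
- by move=> i; rewrite eA in pA; apply: (psd_eigen_ge0 i UU' pA).
- by rewrite eA char_poly_conj // char_poly_diag_mx.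
- rewrite eA mxtrace_mulC mulmxA UU' mul1mx mxtrace_diag rmorph_sum.
  by apply: eq_bigr => i _; rewrite mxE.
Qed.

Lemma trace_norm_hermitian n (U : 'M[C]_n) (x : 'I_n -> R) :
  adjmx U *m U = 1%:M -> U *m adjmx U = 1%:M ->
  trace_norm (U *m diag_mx (\row_i (x i)%:C%C) *m adjmx U) = \sum_i `|x i|.
Proof.
move=> UU' U'U; set D := diag_mx _.
rewrite (@trace_normE _ _ (fun i => x i ^+ 2)); first last.
- rewrite !adjmxM adjmxK !mulmxA -(mulmxA _ (adjmx U) U) UU' mulmx1.
  rewrite -(mulmxA U) char_poly_conj // -char_poly_diag_mx; congr char_poly.
  apply/matrixP => i j; rewrite !mxE (bigD1 i) //= big1 ?addr0 => [|k ki].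
    rewrite !mxE eqxx; case: eqVneq => [->|ij]; last by rewrite !mulr0n mulr0.
    by rewrite !mulr1n conjC_realc -rmorphM.
  by rewrite !mxE (negPf ki) mulr0n conjC0 mul0r.
- by move=> i; rewrite sqr_ge0.
by apply: eq_bigr => i _; rewrite sqrtr_sqr.
Qed.

(** In an eigenbasis of [A - B] each eigenvalue is a difference of two nonnegative diagonal entries,
    so its modulus is at most their sum. *)
Lemma trace_norm_psdB n (A B : 'M[C]_n) : psd A -> psd B ->
  ((trace_norm (A - B))%:C%C : C) <= \tr A + \tr B.
Proof.
move=> pA pB.
have hAB : is_hermitian (A - B) by rewrite /is_hermitian adjmxB pA.1 pB.1.
have [U [x [UU' U'U eAB]]] := hermitian_spectral hAB.
rewrite {1}eAB trace_norm_hermitian // rmorph_sum /=.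
have trU M : \tr M = \tr (adjmx U *m M *m U).
  by rewrite mxtrace_mulC mulmxA U'U mul1mx.
rewrite (trU A) (trU B) /mxtrace -big_split /=; apply: ler_sum => i _.
have -> : (`|x i|%:C%C : C) = `|(adjmx U *m (A - B) *m U) i i|.
  rewrite eAB !mulmxA UU' mul1mx -mulmxA UU' mulmx1 !mxE eqxx mulr1n.
  by rewrite normc_def /= expr0n addr0 sqrtr_sqr.
rewrite mulmxBr mulmxBl mxE [X in _ + X]mxE; apply: (le_trans (ler_normB _ _)).
have := psd_diag_ge0 i (psd_conj (adjmx U) pA); rewrite adjmxK => /ger0_norm ->.
by have := psd_diag_ge0 i (psd_conj (adjmx U) pB); rewrite adjmxK => /ger0_norm ->.
Qed.

(** The left side is the trace of [(1 - 2 E) Y]. In an eigenbasis of [Y] the diagonal entries of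
    [1 - 2 E] lie in [[-1, 1]], because [E] and [1 - E] are positive semidefinite. *)
Lemma trace_norm_ge_proj n (E Y : 'M[C]_n) :
  is_hermitian Y -> is_hermitian E -> E *m E = E ->
  \tr Y - 2 * \tr (E *m Y) <= ((trace_norm Y)%:C%C : C).
Proof.
move=> hY hE EE; have [U [x [UU' U'U eY]]] := hermitian_spectral hY.
rewrite [in leRHS]eY trace_norm_hermitian // rmorph_sum /=.
set D := diag_mx _ in eY.
have pE : psd E by have := psd_gram E; rewrite hE EE.
have pE' : psd (1%:M - E).
  have := psd_gram (1%:M - E); rewrite adjmxB hE adjmx1.
  by rewrite mulmxBl mul1mx mulmxBr mulmx1 EE subrr subr0.
have -> : \tr Y - 2 * \tr (E *m Y) =
    \sum_i ((1 - 2 * (adjmx U *m E *m U) i i) * (x i)%:C%C).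
  under eq_bigr do rewrite mulrBl mul1r -mulrA.
  rewrite sumrB -mulr_sumr; congr (_ - 2 * _).
    rewrite eY mxtrace_mulC mulmxA UU' mul1mx mxtrace_diag.
    by apply: eq_bigr => i _; rewrite mxE.
  rewrite eY !mulmxA mxtrace_mulC !mulmxA; apply: eq_bigr => i _.
  rewrite mxE (bigD1 i) //= big1 ?addr0 => [|k ki].
    by rewrite !mxE eqxx mulr1n.
  by rewrite [X in _ * X]mxE (negPf ki) mulr0n mulr0.
apply: ler_sum => i _.
have := psd_diag_ge0 i (psd_conj (adjmx U) pE); rewrite adjmxK => p0.
have := psd_diag_ge0 i (psd_conj (adjmx U) pE'); rewrite adjmxK => p1.
rewrite mulmxBr mulmx1 mulmxBl UU' !mxE eqxx mulr1n in p1.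
rewrite !mxE in p0 p1 *; move: p0 p1; set p := (\sum_j _) => p0 p1.
have -> : (`|x i|%:C%C : C) = `|(x i)%:C%C|.
  by rewrite normc_def /= expr0n addr0 sqrtr_sqr.
have rx : (x i)%:C%C \is @Num.real C by rewrite complex_real.
have rp : p \is Num.real by rewrite ger0_real.
have r1 : 1 - 2 * p \is Num.real.
  by apply: realB; [exact: real1 | apply: realM => //; exact: realn].
apply: (le_trans (real_ler_norm (realM r1 rx))).
rewrite normrM ler_piMl // real_ler_norml //; apply/andP; split.
  rewrite -subr_ge0 (_ : _ - _ = 2 * (1 - p)) ?mulr_ge0 //; ring.
by rewrite lerBlDr lerDl mulr_ge0.
Qed.

End HermitianMatrices.

(** * Lower bounds on the diamond norm *)

Section DiamondNorm.
Variable R : realType.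
Local Notation C := R[i].

Lemma is_linear_mapZ n m (f : 'M[C]_n -> 'M[C]_m) a X :
  is_linear_map f -> f (a *: X) = a *: f X.
Proof.
move=> lf; have f0 : f 0 = 0.
  by have := lf 1 0 0; rewrite !scale1r addr0 => /eqP; rewrite -subr_eq0 opprD addNKr oppr_eq0 => /eqP.
by rewrite -[a *: X]addr0 lf f0 addr0.
Qed.

Lemma is_linear_mapD n m (f : 'M[C]_n -> 'M[C]_m) X Y :
  is_linear_map f -> f (X + Y) = f X + f Y.
Proof. by move=> lf; have := lf 1 X Y; rewrite !scale1r. Qed.

Lemma is_linear_map_sum n m (f : 'M[C]_n -> 'M[C]_m) I (r : seq I) F :
  is_linear_map f -> f (\sum_(i <- r) F i) = \sum_(i <- r) f (F i).
Proof.
move=> lf; elim/big_rec2: _ => [|i A B _ <-]; last by rewrite is_linear_mapD.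
by rewrite -(scale0r 0) is_linear_mapZ // scale0r.
Qed.

Lemma is_linear_mapE n m (f : 'M[C]_n -> 'M[C]_m) X : is_linear_map f ->
  f X = \sum_i \sum_j X i j *: f (delta_mx i j).
Proof.
move=> lf; rewrite {1}[X]matrix_sum_delta is_linear_map_sum //.
apply: eq_bigr => i _; rewrite is_linear_map_sum //.
by apply: eq_bigr => j _; rewrite is_linear_mapZ.
Qed.

(** The left side is the sum of the squared singular values, which is at most the square of their
    sum. *)
Lemma frobenius_le_trace_norm n (X : 'M[C]_n) :
  \sum_i \sum_j `|X j i| ^+ 2 <= ((trace_norm X)%:C%C : C) ^+ 2.
Proof.
have [s [s0 cs trs]] := char_poly_gram X.
rewrite -mxtrace_adj_mul trs (trace_normE s0 cs) -rmorphXn lecR /=.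
rewrite expr2 mulr_suml; apply: ler_sum => i _.
rewrite -[s i in leLHS]sqr_sqrtr // expr2 ler_wpM2l ?sqrtr_ge0 //.
by rewrite (bigD1 i) //= lerDl sumr_ge0 // => j _; apply: sqrtr_ge0.
Qed.

(** Each singular value [q] satisfies [q <= 1 + q ^ 2]. This crude bound is only meant to make a
    supremum finite. *)
Lemma trace_norm_le_frobenius n (X : 'M[C]_n) :
  ((trace_norm X)%:C%C : C) <= n%:R + \sum_i \sum_j `|X j i| ^+ 2.
Proof.
have [s [s0 cs trs]] := char_poly_gram X.
rewrite -mxtrace_adj_mul trs (trace_normE s0 cs).
rewrite -(rmorph_nat (real_complex R)) -rmorphD lecR /=.
rewrite -[n in n%:R]card_ord -sumr_const -big_split; apply: ler_sum => i _ /=.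
rewrite -[s i in leRHS]sqr_sqrtr //; have := sqr_ge0 (Num.sqrt (s i) - 1).
have := sqrtr_ge0 (s i); set q := Num.sqrt _; nra.
Qed.

Lemma diamond_norm_has_ubound n m (f : 'M[C]_n -> 'M[C]_m) : is_linear_map f ->
  has_ubound [set r : R | exists X : 'M[C]_(n * n),
         trace_norm X <= 1 /\ r = trace_norm (tens_id f X)]%classic.
Proof.
move=> lf.
pose B : C := \sum_i \sum_j \sum_a \sum_b `|f (delta_mx i j) a b|.
have B0 : 0 <= B by do 4 (apply: sumr_ge0 => ? _).
exists (complex.Re ((m * n)%:R + \sum_(i < m * n) \sum_(j < m * n) B ^+ 2)) => _ [X [X1 ->]].
have X1' i j : `|X i j| <= 1.
  have := frobenius_le_trace_norm X.
  rewrite (bigD1 j) //= (bigD1 i) //= => h.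
  rewrite -(@expr_le1 _ 2) //.
  have t0 : 0 <= trace_norm X.
    have [s [s0 cs _]] := char_poly_gram X; rewrite (trace_normE s0 cs).
    by apply: sumr_ge0 => k _; apply: sqrtr_ge0.
  apply: (@le_trans _ _ (((trace_norm X)%:C%C : C) ^+ 2)); last first.
    by rewrite expr_le1 ?ler0c // -(rmorph1 (real_complex R)) lecR.
  apply: le_trans h; rewrite -addrA lerDl addr_ge0 //; first last.
    by do 2 (apply: sumr_ge0 => ? _); rewrite exprn_ge0.
  by apply: sumr_ge0 => k _; rewrite exprn_ge0.
suff : ((trace_norm (tens_id f X))%:C%C : C) <=
       (m * n)%:R + \sum_(i < m * n) \sum_(j < m * n) B ^+ 2.
  by rewrite lecE => /andP[].
apply: (le_trans (trace_norm_le_frobenius _)); rewrite lerD2l.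
apply: ler_sum => i _; apply: ler_sum => j _.
rewrite lerXn2r ?nnegrE //= mxE is_linear_mapE // summxE.
apply: (le_trans (ler_norm_sum _ _ _)); apply: ler_sum => k _.
rewrite summxE.
apply: (le_trans (ler_norm_sum _ _ _)); apply: ler_sum => l _.
rewrite !mxE normrM; apply: (@le_trans _ _ `|f (delta_mx k l) (mxtens_unindex j).1 (mxtens_unindex i).1|).
  by rewrite ler_piMl.
rewrite (bigD1 (mxtens_unindex j).1) //= (bigD1 (mxtens_unindex i).1) //=.
rewrite -addrA lerDl addr_ge0 //; first by apply: sumr_ge0.
by do 2 (apply: sumr_ge0 => ? _).
Qed.

Lemma tens_id_tens n m k (f : 'M[C]_n -> 'M[C]_m) (X : 'M[C]_n) (Y : 'M[C]_k) :
  is_linear_map f -> tens_id f (X *t Y) = f X *t Y.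
Proof.
move=> lf; apply/matrixP => a b; rewrite !mxE.
set y := Y _ _.
have -> : f X (mxtens_unindex a).1 (mxtens_unindex b).1 * y =
  (y *: f X) (mxtens_unindex a).1 (mxtens_unindex b).1 by rewrite mxE mulrC.
rewrite -is_linear_mapZ //; congr (f _ _ _); apply/matrixP => i j.
by rewrite !mxE !mxtens_indexK mulrC.
Qed.

(** The test operator is [(A - B) / N] tensored with a pure ancilla state [e]: [trace_norm_psdB]
    puts it in the unit ball, and [trace_norm_ge_proj] with the projection [E *t e] bounds the norm
    of its image from below. *)
Lemma diamond_norm_ge n m (f : 'M[C]_n -> 'M[C]_m) (A B : 'M[C]_n) (E : 'M[C]_m)
    (N : R) : is_linear_map f -> (0 < n)%N -> psd A -> psd B ->
  is_hermitian (f (A - B)) -> is_hermitian E -> E *m E = E ->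
  0 < N -> \tr A + \tr B <= (N%:C%C : C) ->
  \tr (f (A - B)) - 2 * \tr (E *m f (A - B)) <= ((N * diamond_norm f)%:C%C : C).
Proof.
case: n f A B => // n f A B lf _ pA pB hY hE EE N0 trN.
pose e : 'M[C]_n.+1 := delta_mx 0 0.
have he : adjmx e = e.
  apply/matrixP => i j; rewrite !mxE andbC.
  by case: andb; rewrite ?conjC0 ?conjC1.
have ee : e *m e = e by rewrite mul_delta_mx.
have pe : psd e by have := psd_gram e; rewrite he ee.
have tre : \tr e = 1.
  by rewrite /e /mxtrace (bigD1 0) //= big1 ?addr0 => [|i /negPf i0]; rewrite mxE ?eqxx ?i0.
have N0' : 0 <= (N^-1)%:C%C :> C by rewrite ler0c invr_ge0 ltW.
pose X := ((N^-1)%:C%C *: A) *t e - ((N^-1)%:C%C *: B) *t e.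
have pA' := psd_tens (psdZ N0' pA) pe.
have pB' := psd_tens (psdZ N0' pB) pe.
have X1 : trace_norm X <= 1.
  have := trace_norm_psdB pA' pB'; rewrite !mxtrace_tens !mxtraceZ tre !mulr1.
  rewrite -mulrDr => h; rewrite -lecR; apply: (le_trans h).
  by rewrite rmorph1 rmorphV ?unitfE ?gt_eqF //= ler_pdivrMl ?ltcR // mulr1.
have eX : X = ((N^-1)%:C%C *: (A - B)) *t e.
  by apply/matrixP => a b; rewrite !mxE; ring.
have fX : tens_id f X = ((N^-1)%:C%C *: f (A - B)) *t e.
  by rewrite eX tens_id_tens // is_linear_mapZ.
have le1 : trace_norm (tens_id f X) <= diamond_norm f.
  by apply: ub_le_sup; [exact: diamond_norm_has_ubound | exists X].
have : trace_norm (tens_id f X) * N <= diamond_norm f * N by rewrite ler_pM2r.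
rewrite mulrC -lecR [X in _ <= X%:C%C]mulrC; apply: le_trans.
rewrite rmorphM /= -ler_pdivrMl ?ltcR //.
have /= := @trace_norm_ge_proj R _ (E *t e) (tens_id f X).
rewrite fX !tensmx_mul -scalemxAr ee !mxtrace_tens !mxtraceZ tre !mulr1.
rewrite rmorphV ?unitfE ?gt_eqF //= mulrBr mulrCA; apply.
- by rewrite /is_hermitian adjmx_tens adjmxZ he hY -(rmorphV (real_complex R)) ?unitfE ?gt_eqF // conjC_realc.
- by rewrite /is_hermitian adjmx_tens he hE.
- by rewrite EE.
Qed.

End DiamondNorm.

(** * The kernel of a GKSL generator *)

Section GKSLKernel.
Variable R : realType.
Local Notation C := R[i].

Lemma gksl_linear d m H (Ls : 'I_m -> 'M[C]_d) : linear (gksl H Ls).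
Proof.
move=> a X Y; rewrite /gksl [a *: (_ + _)]scalerDr scaler_sumr addrACA -big_split /=.
congr (_ + _).
  rewrite scalerA mulrC -scalerA -scalerDr; congr (_ *: _).
  by rewrite mulmxDr mulmxDl -scalemxAr -scalemxAl scalerBr opprD addrACA.
apply: eq_bigr => k _; rewrite scalerBr addrACA -opprD; congr (_ - _).
  by rewrite mulmxDr mulmxDl -scalemxAr -scalemxAl.
rewrite scalerA mulrC -scalerA -scalerDr; congr (_ *: _).
by rewrite mulmxDr !mulmxDl -!scalemxAr -!scalemxAl scalerDr addrACA.
Qed.

HB.instance Definition _ d m H (Ls : 'I_m -> 'M[C]_d) :=
  GRing.isLinear.Build C 'M[C]_d 'M[C]_d _ (gksl H Ls) (gksl_linear H Ls).

Lemma gksl_trace d m H (Ls : 'I_m -> 'M[C]_d) X : \tr (gksl H Ls X) = 0.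
Proof.
rewrite /gksl mxtraceD mxtraceZ raddfB /= [\tr (X *m H)]mxtrace_mulC subrr mulr0 add0r.
rewrite raddf_sum /= big1 // => k _; rewrite raddfB /= mxtraceZ mxtraceD.
rewrite mxtrace_mulC mulmxA -[X *m _ *m _]mulmxA [\tr (X *m _)]mxtrace_mulC.
by set t := \tr _; field.
Qed.

Lemma gksl_herm d m H (Ls : 'I_m -> 'M[C]_d) X : is_hermitian H ->
  gksl H Ls (adjmx X) = adjmx (gksl H Ls X).
Proof.
move=> hH; rewrite /gksl [RHS]adjmxD [in RHS]adjmx_sum; congr (_ + _).
  rewrite [RHS]adjmxZ [in RHS]adjmxB [in RHS]adjmxM [adjmx (X *m H)]adjmxM hH.
  by rewrite rmorphN /= conjCi opprK -opprB scalerN scaleNr opprK.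
apply: eq_bigr => k _; rewrite [RHS]adjmxB [in RHS]adjmxZ [in RHS]adjmxD.
rewrite [in RHS]adjmxM !adjmxM !adjmxK !mulmxA.
congr (_ - _); rewrite addrC; congr (_ *: _).
by apply/esym/CrealP; rewrite realV realn.
Qed.

(** Unitary covariance reduces questions on Hermitian operators to diagonal ones, at the price of
    changing [H] and [Ls]. *)
Lemma gksl_unitary d m H (Ls : 'I_m -> 'M[C]_d) (U X : 'M[C]_d) :
  adjmx U *m U = 1%:M ->
  gksl (U *m H *m adjmx U) (fun k => U *m Ls k *m adjmx U) (U *m X *m adjmx U) =
  U *m gksl H Ls X *m adjmx U.
Proof.
move=> UU'.
(* Obtained from an existential, [cj] is opaque, so the rewriting below uses only its algebraic
   laws. *)
have [cj cjE] : exists cj : 'M[C]_d -> 'M[C]_d, forall A, cj A = U *m A *m adjmx U.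
  by exists (fun A => U *m A *m adjmx U).
have cjM A B : cj A *m cj B = cj (A *m B).
  by rewrite !cjE !mulmxA -(mulmxA (U *m A) (adjmx U) U) UU' mulmx1.
have cjD A B : cj A + cj B = cj (A + B) by rewrite !cjE mulmxDr mulmxDl.
have cjB A B : cj A - cj B = cj (A - B) by rewrite !cjE mulmxBr mulmxBl.
have cjZ a A : a *: cj A = cj (a *: A) by rewrite !cjE -scalemxAr -scalemxAl.
have cjA A : adjmx (cj A) = cj (adjmx A) by rewrite !cjE !adjmxM adjmxK mulmxA.
rewrite -!cjE /gksl !cjM cjB cjZ -cjD; congr (_ + _).
rewrite [RHS]cjE mulmx_sumr mulmx_suml; apply: eq_bigr => k _.
by rewrite -!cjE cjA !cjM cjD cjZ cjB.
Qed.

Lemma gksl_diag d m H (Ls : 'I_m -> 'M[C]_d) (x : 'I_d -> R) i j :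
  gksl H Ls (diag_mx (\row_i (x i)%:C%C)) i j =
  'i * ((x i)%:C%C - (x j)%:C%C) * H i j
  + \sum_k (\sum_l (x l)%:C%C * (Ls k i l * (Ls k j l)^*)
            - ((x i)%:C%C + (x j)%:C%C) / 2 * (adjmx (Ls k) *m Ls k) i j).
Proof.
rewrite /gksl mxE summxE; congr (_ + _).
  by rewrite mxE mul_mx_diag mul_diag_mx !mxE; ring.
apply: eq_bigr => k _; rewrite mxE; congr (_ + _).
  by rewrite mul_mx_diag mxE; apply: eq_bigr => l _; rewrite !mxE; ring.
rewrite mxE; congr (- _); rewrite mul_mx_diag -mulmxA mul_diag_mx.
by set K := adjmx (Ls k) *m Ls k; rewrite !mxE; field.
Qed.

(** Where [y] vanishes so does the loss term, and only gains [y l * |Ls k i l| ^ 2] remain. *)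
Lemma gksl_diag_ge0 d m H (Ls : 'I_m -> 'M[C]_d) (y : 'I_d -> R) i :
  (forall l, 0 <= y l) -> y i = 0 ->
  0 <= gksl H Ls (diag_mx (\row_i (y i)%:C%C)) i i.
Proof.
move=> y0 yi; rewrite gksl_diag subrr mulr0 mul0r add0r yi addr0 !mul0r.
apply: sumr_ge0 => k _; rewrite mul0r subr0; apply: sumr_ge0 => l _.
by rewrite mulr_ge0 ?ler0c // mul_conjC_ge0.
Qed.

(** A sum of nonnegative gains is zero only if each gain is: no jump leads from the support of [y]
    to [i]. *)
Lemma gksl_diag_eq0 d m H (Ls : 'I_m -> 'M[C]_d) (y : 'I_d -> R) i :
  (forall l, 0 <= y l) -> y i = 0 ->
  gksl H Ls (diag_mx (\row_i (y i)%:C%C)) i i = 0 ->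
  forall k l, y l != 0 -> Ls k i l = 0.
Proof.
move=> y0 yi; rewrite gksl_diag subrr mulr0 mul0r add0r yi addr0 !mul0r => Z0 k l yl.
have F0 k' l' : 0 <= (y l')%:C%C * (Ls k' i l' * (Ls k' i l')^*).
  by rewrite mulr_ge0 ?ler0c // mul_conjC_ge0.
have := psumr_eq0P _ Z0 => /(_ _ k isT).
rewrite mul0r subr0 => h; have : \sum_l (y l)%:C%C * (Ls k i l * (Ls k i l)^* ) = 0.
  by apply: h => k' _; rewrite mul0r subr0; apply: sumr_ge0.
move=> /psumr_eq0P => /(_ (fun l _ => F0 k l) l isT) /eqP.
rewrite mulf_eq0 mul_conjC_eq0 => /orP[|/eqP //].
by rewrite -(rmorph0 (real_complex R)) => /eqP[] /eqP; rewrite (negPf yl).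
Qed.

(** The jump operators preserve two disjoint supports, so between these only the Hamiltonian term
    survives. It is ['i * y i * H i j] for [y] and [- 'i * z j * H i j] for [z]; equality forces
    [(y i + z j) * H i j = 0]. *)
Lemma gksl_diag_cross d m H (Ls : 'I_m -> 'M[C]_d) (y z : 'I_d -> R) i j
    (D := fun x : 'I_d -> R => gksl H Ls (diag_mx (\row_i (x i)%:C%C))) :
  (forall k a l, y a = 0 -> y l != 0 -> Ls k a l = 0) ->
  (forall k a l, z a = 0 -> z l != 0 -> Ls k a l = 0) ->
  (forall a, y a = 0 \/ z a = 0) ->
  0 < y i -> z i = 0 -> y j = 0 -> 0 < z j -> D y = D z -> D y i j = 0.
Proof.
move=> Ly Lz yz yi zi yj zj eD.
have K0 k : (adjmx (Ls k) *m Ls k) i j = 0.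
  rewrite mxE; apply: big1 => a _; rewrite mxE; case: (yz a) => h; first by rewrite (Ly k a i) ?gt_eqF ?conjC0 ?mul0r.
  by rewrite (Lz k a j) ?gt_eqF ?mulr0.
have DyE : D y i j = 'i * (y i)%:C%C * H i j.
  rewrite /D (gksl_diag H Ls y i j) yj [_ - 0%:C%C]subr0 big1 => [|k _]; first by rewrite addr0.
  rewrite K0 mulr0 subr0; apply: big1 => l _.
  have [->|yl] := eqVneq (y l) 0; first by rewrite mul0r.
  by rewrite (Ly k j l yj yl) conjC0 !mulr0.
have DzE : D z i j = - 'i * (z j)%:C%C * H i j.
  rewrite /D (gksl_diag H Ls z i j) zi [0%:C%C - _]sub0r big1 => [|k _]; first by rewrite addr0; ring.
  rewrite K0 mulr0 subr0; apply: big1 => l _.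
  have [->|zl] := eqVneq (z l) 0; first by rewrite mul0r.
  by rewrite (Lz k i l zi zl) mul0r mulr0.
have e := etrans (esym DyE) (etrans (congr1 (fun M : 'M[C]_d => M i j) eD) DzE).
have : 'i * (y i + z j)%:C%C * H i j = 0 :> C.
  by rewrite rmorphD mulrDr mulrDl e !mulNr addNr.
move/eqP; rewrite !mulf_eq0 (negPf (neq0Ci _)) /= => /orP[|/eqP h].
  by rewrite -(rmorph0 (real_complex R)) => /eqP[] /eqP; rewrite gt_eqF ?addr_gt0.
by rewrite DyE h mulr0.
Qed.

(* The diagonal of L(D+) = L(D-) is nonnegative and has zero sum, so the jump
   operators do not leave the supports of D+ and D-. *)
Lemma gksl_diag_pos d m H (Ls : 'I_m -> 'M[C]_d) (x : 'I_d -> R)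
    (D := fun x : 'I_d -> R => gksl H Ls (diag_mx (\row_i (x i)%:C%C))) :
  D x = 0 -> D (fun i => Num.max (x i) 0) = 0.
Proof.
move=> Dx0; set p := (X in D X); pose q i := Num.max (- x i) 0.
have xE i : x i = p i - q i by rewrite /p /q; case: (leP (x i) 0); case: (leP (- x i) 0); lra.
have pq i : p i = 0 \/ q i = 0.
  by rewrite /p /q; case: (leP (x i) 0); case: (leP (- x i) 0); lra.
have p0 i : 0 <= p i by rewrite /p le_max lexx orbT.
have q0 i : 0 <= q i by rewrite /q le_max lexx orbT.
have eD : D p = D q.
  apply/eqP; rewrite -subr_eq0 -raddfB /= -Dx0 /D; apply/eqP; congr gksl.
  apply/matrixP => i j; rewrite !mxE xE rmorphB /=; case: eqP => _; rewrite ?mulr1n //.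
  by rewrite !mulr0n subr0.
have Z0 i : D p i i = 0.
  have Zge0 j : 0 <= D p j j.
    case: (pq j) => h; first exact: gksl_diag_ge0.
    by rewrite eD; apply: gksl_diag_ge0.
  have tr0 : \sum_j D p j j = 0 := gksl_trace H Ls _.
  exact: (psumr_eq0P (P := xpredT) (F := fun j => D p j j) (fun j _ => Zge0 j) tr0).
have Lp k a l : p a = 0 -> p l != 0 -> Ls k a l = 0.
  by move=> pa; apply: (@gksl_diag_eq0 _ _ H Ls p a p0 pa (Z0 a)).
have Lq k a l : q a = 0 -> q l != 0 -> Ls k a l = 0.
  by move=> qa; apply: (@gksl_diag_eq0 _ _ H Ls q a q0 qa); have := Z0 a; rewrite eD.
have D0 (y : 'I_d -> R) i j : (forall k a l, y a = 0 -> y l != 0 -> Ls k a l = 0) ->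
    y i = 0 -> y j = 0 -> D y i j = 0.
  move=> Ly yi yj; rewrite /D gksl_diag yi yj subrr mulr0 mul0r add0r addr0 mul0r.
  apply: big1 => k _; rewrite mul0r subr0; apply: big1 => l _.
  have [->|yl] := eqVneq (y l) 0; first by rewrite mul0r.
  by rewrite (Ly k i l yi yl) mul0r mulr0.
have qp a : q a = 0 \/ p a = 0 by case: (pq a); [right|left].
have gtp a : p a != 0 -> 0 < p a by rewrite lt0r p0 andbT.
have gtq a : q a != 0 -> 0 < q a by rewrite lt0r q0 andbT.
have pNq a : p a != 0 -> q a = 0.
  by case: (pq a) => [e /eqP /(_ e) []|e _].
apply/matrixP => i j; rewrite [RHS]mxE.
(* If [p] or [q] vanishes at both indices, [D0] applies; otherwise one index lies in each support
   and [gksl_diag_cross] applies. *)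
have [pi|pi] := eqVneq (p i) 0; have [pj|pj] := eqVneq (p j) 0.
- exact: (D0 p i j Lp pi pj).
- rewrite eD; have [qi|qi] := eqVneq (q i) 0; first exact: (D0 q i j Lq qi (pNq j pj)).
  exact: (gksl_diag_cross Lq Lp qp (gtq i qi) pi (pNq j pj) (gtp j pj) (esym eD)).
- have [qj|qj] := eqVneq (q j) 0; first by rewrite eD; exact: (D0 q i j Lq (pNq i pi) qj).
  exact: (gksl_diag_cross Lp Lq pq (gtp i pi) (pNq i pi) pj (gtq j qj) eD).
- by rewrite eD; exact: (D0 q i j Lq (pNq i pi) (pNq j pj)).
Qed.

Lemma psd_trace_eq0 n (A : 'M[C]_n) : psd A -> \tr A = 0 -> A = 0.
Proof.
move=> /psd_sqrt[S ->]; rewrite -{1}[S]adjmxK mxtrace_adj_mul => h.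
suff -> : S = 0 by rewrite mul0mx.
apply/matrixP => i j; rewrite [RHS]mxE.
have F0 k l : 0 <= `|adjmx S l k| ^+ 2 by apply: exprn_ge0.
have h1 := psumr_eq0P (fun k _ => sumr_ge0 _ (fun l _ => F0 k l)) h (i := i) isT.
have /eqP := psumr_eq0P (fun l _ => F0 i l) h1 (i := j) isT.
by rewrite mxE expf_eq0 /= normr_eq0 conjC_eq0 => /eqP.
Qed.

(** Uniqueness among states extends to positive operators by normalisation, to Hermitian ones
    because the positive part of a kernel element is again in the kernel, and to all operators by
    splitting off Hermitian components. *)
Lemma gksl_ker d m H (Ls : 'I_m -> 'M[C]_d) (sigma : 'M[C]_d) :
  is_hermitian H ->
  (forall rho, is_density rho -> gksl H Ls rho = 0 -> rho = sigma) ->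
  forall X, gksl H Ls X = 0 -> X = \tr X *: sigma.
Proof.
move=> hH uniq.
have kpsd Y : psd Y -> gksl H Ls Y = 0 -> Y = \tr Y *: sigma.
  move=> pY Y0; have [t0|t0] := eqVneq (\tr Y) 0.
    by rewrite t0 scale0r; apply: psd_trace_eq0.
  rewrite -(uniq ((\tr Y)^-1 *: Y)); first by rewrite scalerA divff ?scale1r.
    split; first by apply: psdZ => //; rewrite invr_ge0 psd_trace_ge0.
    by rewrite mxtraceZ mulVf.
  by rewrite linearZ /= Y0 scaler0.
have kherm Y : is_hermitian Y -> gksl H Ls Y = 0 -> Y = \tr Y *: sigma.
  move=> /hermitian_spectral[U [x [UU' U'U ->]]]; set D := diag_mx _.
  (* The generator seen in the eigenbasis of [Y], where [gksl_diag_pos] is available. *)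
  pose H' := adjmx U *m H *m U; pose L' k := adjmx U *m Ls k *m U.
  have UK A : U *m (adjmx U *m A *m U) *m adjmx U = A :> 'M[C]_d.
    by rewrite !mulmxA U'U mul1mx -mulmxA U'U mulmx1.
  have gU A : gksl H Ls (U *m A *m adjmx U) = U *m gksl H' L' A *m adjmx U.
    rewrite -(gksl_unitary H' L' A UU') [U *m H' *m _]UK.
    suff -> : (fun k => U *m L' k *m adjmx U) = Ls by [].
    by apply/funext => k; apply: UK.
  have U0 A : U *m A *m adjmx U = 0 -> A = 0 :> 'M[C]_d.
    move=> /(congr1 (fun M => adjmx U *m M *m U)).
    by rewrite !mulmxA UU' mul1mx -mulmxA UU' mulmx1 mulmx0 mul0mx.
  move=> k0; rewrite gU in k0; have {}k0 := U0 _ k0.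
  pose p i := Num.max (x i) 0; pose q i := p i - x i.
  pose P : 'M[C]_d := diag_mx (\row_i (p i)%:C%C).
  have kp : gksl H' L' P = 0 := gksl_diag_pos k0.
  pose Q : 'M[C]_d := diag_mx (\row_i (q i)%:C%C).
  have eD : D = P - Q.
    apply/matrixP => i j; rewrite !mxE -mulrnBl -rmorphB /= /q; congr (_%:C%C *+ _); lra.
  have kq : gksl H' L' Q = 0 by rewrite (_ : Q = P - D) ?linearB /= ?kp ?k0 ?subr0 // eD opprB addrC subrK.
  have pP : psd (U *m P *m adjmx U).
    by apply/psd_conj/psd_diag_mx => i; rewrite /p le_max lexx orbT.
  have pQ : psd (U *m Q *m adjmx U).
    apply/psd_conj/psd_diag_mx => i; rewrite /q subr_ge0 /p le_max lexx //.
  have kP : gksl H Ls (U *m P *m adjmx U) = 0 by rewrite gU kp mulmx0 mul0mx.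
  have kQ : gksl H Ls (U *m Q *m adjmx U) = 0 by rewrite gU kq mulmx0 mul0mx.
  rewrite eD mulmxBr mulmxBl raddfB /= scalerBl.
  by rewrite -(kpsd _ pP kP) -(kpsd _ pQ kQ).
move=> X X0; have X0' : gksl H Ls (adjmx X) = 0.
  by rewrite gksl_herm // X0; apply/matrixP => i j; rewrite !mxE conjC0.
(* Both are Hermitian and lie in the kernel, and [X = (A - 'i B) / 2]. *)
pose A := X + adjmx X; pose B := 'i *: (X - adjmx X).
have hA : is_hermitian A by rewrite /is_hermitian adjmxD adjmxK addrC.
have hB : is_hermitian B.
  by rewrite /is_hermitian adjmxZ adjmxB adjmxK conjCi scaleNr -scalerN opprB.
have A0 : A = \tr A *: sigma.
  by apply: (kherm _ hA); rewrite linearD /= X0 X0' addr0.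
have B0 : B = \tr B *: sigma.
  by apply: (kherm _ hB); rewrite linearZ linearB /= X0 X0' subr0 scaler0.
have eX : X = 2^-1 *: (A - 'i *: B).
  rewrite /B scalerA -expr2 sqrCi scaleN1r opprK /A addrACA subrr addr0 -mulr2n.
  by rewrite -[X *+ 2]scaler_nat scalerA mulVf ?scale1r // pnatr_eq0.
have tX : \tr X = 2^-1 * (\tr A - 'i * \tr B).
  by rewrite [in LHS]eX mxtraceZ raddfB /= mxtraceZ.
by rewrite tX -scalerA scalerBl -scalerA -A0 -B0.
Qed.

End GKSLKernel.

(** * From the exponential of a matrix to its powers *)

Section ExponentialFunctionals.
Variable R : realType.
Local Notation C := R[i].

(** For small [t] the first nonzero term [a k * t ^ k] would dominate the tail, which is at most
    [t ^ k.+1 * B]. *)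
Lemma power_series_eq0 (a : nat -> R) (B T : R) : 0 < T ->
  (forall N, \sum_(k < N) `|a k| <= B) ->
  (forall t, 0 <= t <= T -> (\sum_(k < N) a k * t ^+ k @[N --> \oo] --> (0 : R))%classic) ->
  forall k, a k = 0.
Proof.
move=> T0 aB cva k; elim/ltn_ind: k => k IH; apply/eqP; case: eqVneq => // ak0.
have B0 : 0 <= B by have := aB 0%N; rewrite big_ord0.
pose al := `|a k|; have al0 : 0 < al by rewrite normr_gt0.
(* [t <= T] allows the hypothesis, [t <= 1] bounds higher powers by [t ^ k.+1], and the last term
   gives [t * B <= al / 4]. Tail and partial sum are then each at most [t ^ k * al / 4], too small
   for [t ^ k * al]. *)
pose t := Num.min (Num.min T 1) (al / (4 * (B + 1))).
have B1 : 0 < 4 * (B + 1) by lra.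
have t0 : 0 < t by rewrite /t !lt_min T0 ltr01 divr_gt0.
have tT : t <= T by rewrite /t !ge_min lexx.
have t1 : t <= 1 by rewrite /t !ge_min lexx orbT.
have tB : t * B <= al / 4.
  have : t <= al / (4 * (B + 1)) by rewrite /t ge_min lexx orbT.
  rewrite ler_pdivlMr // => h; have := mulr_ge0 (ltW t0) B0; nra.
have tk0 : 0 < t ^+ k by rewrite exprn_gt0.
have e0 : 0 < t ^+ k * (al / 4) by rewrite mulr_gt0 // divr_gt0.
have /cva /cvgrPdist_lt /(_ _ e0) [N _ HN] : 0 <= t <= T by rewrite ltW.
have := HN (maxn N k.+1) (leq_maxl _ _); set M := maxn N k.+1.
have kM : (k < M)%N by rewrite leq_max ltnSn orbT.
rewrite sub0r normrN /= (bigD1 (Ordinal kM)) //=; set S := \sum_(i | _) _ => hS.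
have : `|S| <= t ^+ k.+1 * B.
  apply: (le_trans (ler_norm_sum _ _ _)).
  apply: (@le_trans _ _ (\sum_(j < M | j != Ordinal kM) t ^+ k.+1 * `|a j|)); last first.
    rewrite -mulr_sumr; apply: ler_wpM2l; first by rewrite exprn_ge0 ?ltW.
    apply: le_trans (aB M).
    by rewrite [leRHS](bigD1 (Ordinal kM)) //= lerDr.
  apply: ler_sum => j jk; rewrite normrM mulrC.
  case: (ltngtP j k) => [jk'|jk'|jk']; last by rewrite -val_eqE /= jk' eqxx in jk.
    by rewrite IH // normr0 !mulr0.
  rewrite ler_wpM2r // normrX gtr0_norm //.
  by rewrite ler_wiXn2l // ltW.
rewrite exprS -mulrA mulrCA => hS2.
have : `|a k * t ^+ k| <= `|a k * t ^+ k + S| + `|S|.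
  by rewrite -{1}(addrK S (a k * t ^+ k)) ler_normB.
rewrite normrM (gtr0_norm tk0) -/al => h.
have := ler_wpM2l (ltW tk0) tB; nra.
Qed.

Lemma sum_exp_coeff_le (c : R) N : 0 <= c ->
  \sum_(k < N) c ^+ k / k`!%:R <= expR c.
Proof.
move=> c0; rewrite -(big_mkord xpredT (fun k => c ^+ k / k`!%:R)).
apply: (@nondecreasing_cvgn_le _ (series (exp_coeff c))).
  apply: nondecreasing_series => k _ _; exact: exp_coeff_ge0.
exact: is_cvg_series_exp_coeff.
Qed.

(** The sum [c] of the moduli of all entries bounds every absolute row sum, so each further factor
    [A] costs at most [c]. *)
Lemma exprmx_entry_bound n (A : 'M[C]_n) : exists2 c : R, 0 <= c &
  forall k i j, `|(A ^+ k) i j| <= ((c ^+ k)%:C%C : C).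
Proof.
pose b : C := \sum_i \sum_j `|A i j|.
have b0 : 0 <= b by do 2 (apply: sumr_ge0 => ? _).
have bE : b = (complex.Re b)%:C%C by rewrite RRe_real // ger0_real.
exists (complex.Re b) => [|k]; first by rewrite -ler0c -bE.
rewrite rmorphXn /= -bE; elim: k => [|k IH] i j.
  by rewrite !expr0 mxE; case: eqP => _; rewrite ?normr1 ?normr0 ?ler01.
rewrite !exprS mxE; apply: (le_trans (ler_norm_sum _ _ _)).
apply: (@le_trans _ _ (\sum_l `|A i l| * b ^+ k)).
  by apply: ler_sum => l _; rewrite normrM ler_wpM2l.
rewrite -mulr_suml ler_wpM2r ?exprn_ge0 // /b [leRHS](bigD1 i) //= lerDl.
by do 2 (apply: sumr_ge0 => ? _).
Qed.

Lemma cvgn_sum I (r : seq I) (F : I -> nat -> R) (l : I -> R) :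
  (forall i, F i N @[N --> \oo] --> l i)%classic ->
  (\sum_(i <- r) F i N @[N --> \oo] --> \sum_(i <- r) l i)%classic.
Proof.
move=> cF; elim: r => [|i r IH].
  by rewrite big_nil; under eq_fun do rewrite big_nil; apply: cvg_cst.
by rewrite big_cons; under eq_fun do rewrite big_cons; apply: cvgD.
Qed.

Lemma scalemx_exp n (a : C) (A : 'M[C]_n) k : (a *: A) ^+ k = a ^+ k *: A ^+ k.
Proof.
elim: k => [|k IH]; first by rewrite !expr0 scale1r.
rewrite !exprS IH -[LHS]/(_ *m _) -[A * _]/(_ *m _).
by rewrite -scalemxAl -scalemxAr scalerA.
Qed.

Lemma real_functional_sum (phi : C -> R) I (r : seq I) P F :
  {morph phi : x y / x + y} ->
  phi (\sum_(i <- r | P i) F i) = \sum_(i <- r | P i) phi (F i).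
Proof.
move=> phiD; apply: (big_morph _ phiD).
by apply: (addIr (phi 0)); rewrite -phiD !add0r.
Qed.

(** Domination by the exponential series of [c]. The functional [phi] stands for the real and the
    imaginary part, treated together. *)
Lemma expmx_partial_cvg n (A : 'M[C]_n) i j (phi : C -> R) :
  {morph phi : x y / x + y} -> (forall z, (`|phi z|%:C%C : C) <= `|z|) ->
  cvgn (fun N => phi (expmx_partial A N i j)).
Proof.
move=> phiD phile; have [c c0 Ac] := exprmx_entry_bound A.
pose u k := phi (((k`!%:R)^-1 *: A ^+ k) i j).
suff -> : (fun N => phi (expmx_partial A N i j)) = series u.
  apply: normed_cvg; apply: (series_le_cvg _ _ _ (@is_cvg_series_exp_coeff _ c)) => k.
  - exact: normr_ge0.
  - exact: exp_coeff_ge0.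
  - rewrite /u -lecR; apply: (le_trans (phile _)).
    rewrite mxE normrM mulrC /exp_coeff /= rmorphM /= ler_pM //.
    by rewrite rmorphV ?unitfE ?pnatr_eq0 -?lt0n ?fact_gt0 //= rmorph_nat ger0_norm ?invr_ge0.
apply/funext => N; rewrite /series /= big_mkord /expmx_partial summxE.
exact: real_functional_sum.
Qed.

Lemma Im_norm_le (z : C) : (`|complex.Im z|%:C%C : C) <= `|z|.
Proof.
rewrite normc_def lecR -sqrtr_sqr ler_wsqrtr // lerDr; exact: sqr_ge0.
Qed.

Lemma ReD : {morph (@complex.Re R) : x y / x + y}.
Proof. by move=> [a b] [c d]. Qed.

Lemma ImD : {morph (@complex.Im R) : x y / x + y}.
Proof. by move=> [a b] [c d]. Qed.

Lemma ReZ (r : R) (z : C) : complex.Re (r%:C%C * z) = r * complex.Re z.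
Proof. by case: z => a b /=; rewrite mul0r subr0. Qed.

Lemma ImZ (r : R) (z : C) : complex.Im (r%:C%C * z) = r * complex.Im z.
Proof. by case: z => a b /=; rewrite mul0r addr0. Qed.

Lemma expmx_Re_cvg n (A : 'M[C]_n) i j :
  (complex.Re (expmx_partial A N i j) @[N --> \oo] --> complex.Re (expmx A i j))%classic.
Proof. by rewrite mxE; apply: expmx_partial_cvg; [exact: ReD|exact: normc_ge_Re]. Qed.

Lemma expmx_Im_cvg n (A : 'M[C]_n) i j :
  (complex.Im (expmx_partial A N i j) @[N --> \oo] --> complex.Im (expmx A i j))%classic.
Proof. by rewrite mxE; apply: expmx_partial_cvg; [exact: ImD|exact: Im_norm_le]. Qed.

(** Pairing [exp (t A)] with [w] gives a power series in [t] whose coefficients are the pairings of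
    [A ^+ k] with [w], over [k!]. As it vanishes on [[0, T]], [power_series_eq0] applies. *)
Lemma expmx_functional_real n (A : 'M[C]_n) (w : 'M[C]_n) (T : R) (phi : C -> R) :
  {morph phi : x y / x + y} -> (forall r z, phi (r%:C%C * z) = r * phi z) ->
  (forall z, (`|phi z|%:C%C : C) <= `|z|) -> 0 < T ->
  (forall t : R, 0 <= t <= T -> \sum_i \sum_j expmx (t%:C%C *: A) i j * w i j = 0) ->
  forall k, phi (\sum_i \sum_j (A ^+ k) i j * w i j) = 0.
Proof.
move=> phiD phiZ phile T0 E0 k.
pose u k := phi (\sum_i \sum_j (A ^+ k) i j * w i j).
have phi0 : phi 0 = 0 by rewrite -(mul0r 0) -(rmorph0 (real_complex R)) phiZ mul0r.
have [c c0 Ac] := exprmx_entry_bound A.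
pose W : C := \sum_i \sum_j `|w i j|.
have W0 : 0 <= W by do 2 (apply: sumr_ge0 => ? _).
have WE : W = (complex.Re W)%:C%C by rewrite RRe_real // ger0_real.
suff /eqP : u k / k`!%:R = 0.
  by rewrite mulf_eq0 invr_eq0 pnatr_eq0 (gtn_eqF (fact_gt0 k)) orbF => /eqP.
apply: (@power_series_eq0 (fun k => u k / k`!%:R) (expR c * complex.Re W) T) => // {k}.
- move=> N; apply: (@le_trans _ _ (\sum_(k < N) c ^+ k / k`!%:R * complex.Re W)); last first.
    rewrite -mulr_suml ler_wpM2r ?sum_exp_coeff_le //.
    by rewrite -ler0c -WE.
  apply: ler_sum => k _; rewrite normrM [X in _ * X]ger0_norm ?invr_ge0 //.
  rewrite mulrAC ler_wpM2r ?invr_ge0 //.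
  rewrite -lecR; apply: (le_trans (phile _)); rewrite rmorphM /= -WE mulr_sumr.
  apply: (le_trans (ler_norm_sum _ _ _)); apply: ler_sum => i _; rewrite mulr_sumr.
  apply: (le_trans (ler_norm_sum _ _ _)); apply: ler_sum => j _.
  by rewrite normrM ler_wpM2r.
- move=> t tT.
  (* [expmx] is defined by separate limits of real and imaginary parts, so the pairing is expanded
     in these before passing to the limit. *)
  have phiM z v : phi (z * v) = complex.Re z * phi v + complex.Im z * phi ('i%C * v).
    by rewrite {1}[z]complexE mulrDl phiD phiZ ['i%C * _ in LHS]mulrC -mulrA phiZ.
  have -> : (fun N => \sum_(k < N) u k / k`!%:R * t ^+ k) = fun N => 
    \sum_i \sum_j (complex.Re (expmx_partial (t%:C%C *: A) N i j) * phi (w i j)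
     + complex.Im (expmx_partial (t%:C%C *: A) N i j) * phi ('i%C * w i j)).
    apply/funext => N.
    under [RHS]eq_bigr do under eq_bigr do rewrite -phiM.
    under [RHS]eq_bigr do rewrite -real_functional_sum //.
    rewrite -real_functional_sum //.
    have -> : \sum_i \sum_j expmx_partial (t%:C%C *: A) N i j * w i j =
      \sum_(k < N) (t ^+ k / k`!%:R)%:C%C * \sum_i \sum_j (A ^+ k) i j * w i j.
      under eq_bigr do under eq_bigr do rewrite summxE mulr_suml.
      under eq_bigr do rewrite exchange_big.
      rewrite exchange_big; apply: eq_bigr => k _ /=.
      rewrite mulr_sumr; apply: eq_bigr => i _; rewrite mulr_sumr; apply: eq_bigr => j _.
      rewrite scalemx_exp !mxE mulrA; congr (_ * _); rewrite mulrA; congr (_ * _).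
      rewrite rmorphM rmorphXn mulrC; congr (_ * _).
      by rewrite rmorphV ?unitfE ?pnatr_eq0 -?lt0n ?fact_gt0 //= rmorph_nat.
    rewrite real_functional_sum //; apply: eq_bigr => k _; rewrite phiZ -/(u k).
    by rewrite mulrC mulrA mulrAC.
  have lim0 : \sum_i \sum_j (complex.Re (expmx (t%:C%C *: A) i j) * phi (w i j)
     + complex.Im (expmx (t%:C%C *: A) i j) * phi ('i%C * w i j)) = 0.
    under eq_bigr do under eq_bigr do rewrite -phiM.
    under eq_bigr do rewrite -real_functional_sum //.
    by rewrite -real_functional_sum // E0.
  rewrite -[X in (_ --> X)%classic]lim0.
  apply: cvgn_sum => i; apply: cvgn_sum => j; apply: cvgD; apply: cvgMr_tmp.
    exact: expmx_Re_cvg.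
  exact: expmx_Im_cvg.
Qed.

Lemma expmx_functional n (A : 'M[C]_n) (w : 'M[C]_n) (T : R) : 0 < T ->
  (forall t : R, 0 <= t <= T -> \sum_i \sum_j expmx (t%:C%C *: A) i j * w i j = 0) ->
  forall k, \sum_i \sum_j (A ^+ k) i j * w i j = 0.
Proof.
move=> T0 E0 k; rewrite [LHS]complexE.
rewrite (expmx_functional_real ReD ReZ (@normc_ge_Re R) T0 E0).
by rewrite (expmx_functional_real ImD ImZ Im_norm_le T0 E0) mulr0 addr0.
Qed.

End ExponentialFunctionals.

(** * Programming the projection on the steady state *)

Section SteadyProjection.
Variable R : realType.
Local Notation C := R[i].

(** Cayley-Hamilton, after splitting off from the characteristic polynomial the power of ['X] given
    by the multiplicity of the root 0. *)
Lemma annihilating_poly n (A : 'M[C]_n) : exists (r : {poly C}) (m : nat),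
  r.[0] != 0 /\ (\sum_(k < size r) r`_k *: A ^+ k) *m A ^+ m = 0.
Proof.
case: n A => [|n] A; first by exists 1, 0%N; rewrite hornerC oner_neq0 [LHS]flatmx0.
have [m [r r0 cr]] := multiplicity_XsubC (char_poly A) 0.
exists r, m; split.
  by move: r0; rewrite monic_neq0 ?char_poly_monic.
have -> : \sum_(k < size r) r`_k *: A ^+ k = horner_mx A r.
  rewrite -[r in RHS]coefK poly_def linear_sum /=.
  by apply: eq_bigr => k _; rewrite linearZ /= rmorphXn /= horner_mx_X.
have := Cayley_Hamilton A; rewrite cr subr0 rmorphM rmorphXn /= horner_mx_X.
by [].
Qed.

(** Maps are represented by matrices acting on row vectorisations, as in [semigroup], so
    exponentials and polynomials of the generator are points of one matrix space. *)
Definition superop d (M : 'M[C]_(d * d)) (X : 'M[C]_d) : 'M[C]_d :=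
  vec_mx (mxvec X *m M).

Lemma superop_is_linear d (X : 'M[C]_d) : linear ((@superop d)^~ X).
Proof. by move=> a M N; rewrite /superop mulmxDr -scalemxAr linearP. Qed.

Lemma superop_exp d (L : {linear 'M[C]_d -> 'M[C]_d}) k X :
  superop (lin_mx L ^+ k) X = iter k L X.
Proof.
elim: k => [|k IH]; first by rewrite /superop mulmx1 mxvecK.
rewrite /superop exprSr -[_ * _]/(_ *m _) mulmxA -[mxvec X *m _]vec_mxK.
by rewrite -/(superop _ X) IH mul_vec_lin mxvecK.
Qed.

(* For char_poly L = 'X^m * r with r.[0] != 0, the map r(L) is a multiple of the
   spectral projection on ker L; it exists because ker L meets im L trivially. *)
Lemma steady_projection d (L : {linear 'M[C]_d -> 'M[C]_d}) (sigma : 'M[C]_d) :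
  (forall X, \tr (L X) = 0) -> (forall X, L X = 0 -> X = \tr X *: sigma) ->
  exists2 r : {poly C}, r.[0] != 0 &
    forall X, superop (\sum_(k < size r) r`_k *: lin_mx L ^+ k) X
              = (r.[0] * \tr X) *: sigma.
Proof.
move=> trL kerL; have [r [m [r0 rA0]]] := annihilating_poly (lin_mx L).
exists r => // X; set Q := \sum_(k < _) _ in rA0 *; set Y := superop Q X.
have Ym : iter m L Y = 0.
  rewrite -superop_exp /superop /Y /superop vec_mxK -mulmxA rA0 mulmx0.
  exact: linear0.
have LY : L Y = 0.
  (* A kernel element in the image of [L] is traceless, hence zero; this strips off powers of [L]
     one at a time. *)
  elim: m Ym {rA0} => [/= ->|[|m] IH //= h]; first exact: linear0.
  by apply: IH; rewrite /= (kerL _ h) trL scale0r.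
rewrite [LHS](kerL _ LY); congr (_ *: _).
(* Only the constant term contributes to the trace, as [L] has traceless image. *)
have -> : Y = \sum_(k < size r) r`_k *: iter k L X.
  rewrite /Y /superop mulmx_sumr linear_sum; apply: eq_bigr => k _ /=.
  by rewrite -scalemxAr linearZ /= -/(superop _ X) superop_exp.
have rs : (0 < size r)%N.
  by rewrite lt0n size_poly_eq0; apply: contraNneq r0 => ->; rewrite horner0.
rewrite linear_sum /= (bigD1 (Ordinal rs)) //= big1 ?addr0 => [|[[|k] hk] //= _].
  by rewrite linearZ /= horner_coef0.
by rewrite linearZ /= trL mulr0.
Qed.

Lemma choi_is_linear d : linear (fun M : 'M[C]_(d * d) => choi (superop M)).
Proof.
move=> a M N; rewrite /choi scaler_sumr -big_split; apply: eq_bigr => i _ /=.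
rewrite scaler_sumr -big_split; apply: eq_bigr => j _ /=.
by rewrite superop_is_linear; apply/matrixP => x y; rewrite !mxE; ring.
Qed.

(** The programming identity is linear in the programmed map, so it passes from [exp (t L)] to every
    power of [L], and then to polynomials in [L]. *)
Lemma program_steady d (L : {linear 'M[C]_d -> 'M[C]_d}) (sigma : 'M[C]_d)
    (P : 'M[C]_(d * (d * d)) -> 'M[C]_d) (T : R) :
  (forall X, \tr (L X) = 0) -> (forall X, L X = 0 -> X = \tr X *: sigma) ->
  is_linear_map P -> 0 < T ->
  (forall t : R, 0 <= t <= T -> forall X, P (X *t choi_program L t) = semigroup L t X) ->
  (forall X, P (X *t ((d%:R)^-1 *: choi id)) = X) /\
  (forall X, P (X *t ((d%:R)^-1 *: (1%:M *t sigma))) = \tr X *: sigma).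
Proof.
move=> trL kerL lP T0 PL.
(* The defect of the programming identity when the map with matrix [M] replaces the semigroup. *)
pose G X (M : 'M[C]_(d * d)) :=
  P (X *t ((d%:R)^-1 *: choi (superop M))) - superop M X.
have lG X : is_linear_map (G X).
  move=> a M N; rewrite /G choi_is_linear superop_is_linear.
  rewrite (_ : X *t _ = a *: (X *t ((d%:R)^-1 *: choi (superop M))) +
     X *t ((d%:R)^-1 *: choi (superop N))); last first.
    by apply/matrixP => x y; rewrite !mxE; ring.
  by rewrite lP scalerBr opprD addrACA.
have Gpow X k : G X (lin_mx L ^+ k) = 0.
  apply/matrixP => a b; rewrite [RHS]mxE.
  pose w : 'M[C]_(d * d) := \matrix_(i, j) G X (delta_mx i j) a b.
  have GE M : G X M a b = \sum_i \sum_j M i j * w i j.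
    rewrite (is_linear_mapE M (lG X)) summxE; apply: eq_bigr => i _.
    by rewrite summxE; apply: eq_bigr => j _; rewrite mxE [w i j]mxE.
  rewrite GE; apply: (expmx_functional T0) => t tT; rewrite -GE.
  rewrite /G (PL t tT) subrr; exact: mxE.
(* The zeroth power gives the first identity, the polynomial of [steady_projection] the second. *)
split=> X.
  have := Gpow X 0%N; rewrite /G => /eqP; rewrite subr_eq0 => /eqP.
  rewrite superop_exp /= => {2}<-; congr (P (_ *t (_ *: choi _))).
  by apply/funext => Y; rewrite superop_exp.
have [r r0 rL] := steady_projection trL kerL.
have : G X (\sum_(k < size r) r`_k *: lin_mx L ^+ k) = 0.
  rewrite is_linear_map_sum // big1 // => k _.
  by rewrite is_linear_mapZ // Gpow scaler0.
rewrite /G rL => /eqP; rewrite subr_eq0 => /eqP.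
rewrite (_ : choi _ = r.[0] *: (1%:M *t sigma)); last first.
  rewrite /choi; under eq_bigr do under eq_bigr do rewrite rL.
  have -> : (1%:M : 'M[C]_d) = \sum_i delta_mx i i.
    apply/matrixP => a b; rewrite summxE mxE (bigD1 a) //= big1 ?addr0 => [|i ia].
      by rewrite !mxE eqxx eq_sym.
    by rewrite mxE eq_sym (negPf ia).
  have -> : forall (F : 'I_d -> 'M[C]_d), (\sum_i F i) *t sigma = \sum_i (F i *t sigma).
    by move=> F; apply/matrixP => a b; rewrite !mxE !summxE mulr_suml; apply: eq_bigr => i _; rewrite !mxE.
  rewrite scaler_sumr; apply: eq_bigr => i _.
  rewrite (bigD1 i) //= big1 ?addr0 => [|j ji].
    have -> : \tr (delta_mx i i : 'M[C]_d) = 1.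
      by rewrite /mxtrace (bigD1 i) //= big1 ?addr0 => [|k ki]; rewrite mxE ?eqxx ?(negPf ki).
    by apply/matrixP => a b; rewrite !mxE; ring.
  have -> : \tr (delta_mx i j : 'M[C]_d) = 0.
    apply: big1 => k _; rewrite mxE.
    by case: eqVneq => // ->; rewrite eq_sym (negPf ji).
  by rewrite mulr0 scale0r tensmx0.
rewrite (_ : X *t _ = r.[0] *: (X *t ((d%:R)^-1 *: (1%:M *t sigma)))); last first.
  by apply/matrixP => a b; rewrite !mxE; ring.
by rewrite is_linear_mapZ // -scalerA => /(scalerI r0).
Qed.

End SteadyProjection.

(** * The maximally entangled state and the test operators *)

Section MaximallyEntangled.
Variable R : realType.
Local Notation C := R[i].

(* Completing the square in the off-diagonal block W of omega: A collects the
   block orthogonal to Phi and the remainder W W^* / b, which vanishes as b grows. *)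
Lemma psd_decomposition n (om Phi : 'M[C]_n) (q b : R) :
  psd om -> is_hermitian Phi -> Phi *m Phi = Phi ->
  Phi *m om *m Phi = q%:C%C *: Phi -> \tr om = 1 -> \tr Phi = 1 -> 0 < b ->
  let W := om *m Phi - q%:C%C *: Phi in
  exists A B : 'M[C]_n, [/\ psd A, psd B, om - (b + q)%:C%C *: Phi = A - B &
    \tr A + \tr B = 1 - q%:C%C + b%:C%C + 2 * (b%:C%C)^-1 * \tr (W *m adjmx W)].
Proof.
move=> pom hP PP PoP tro trP b0 W.
have bC0 : b%:C%C != 0 :> C by rewrite -(rmorph0 (real_complex R)) (inj_eq (@complexI _)) gt_eqF.
have ib0 : 0 <= (b%:C%C)^-1 :> C by rewrite invr_ge0 ler0c ltW.
have WP : W *m Phi = W by rewrite /W mulmxBl -mulmxA PP -scalemxAl PP.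
have PW' : Phi *m adjmx W = adjmx W by rewrite -{1}hP -adjmxM WP.
have W'E : adjmx W = Phi *m om - q%:C%C *: Phi.
  by rewrite /W adjmxB adjmxZ adjmxM hP pom.1 conjC_realc.
pose Q := 1%:M - Phi; have hQ : adjmx Q = Q by rewrite /Q adjmxB adjmx1 hP.
have QoQ : Q *m om *m adjmx Q = om - Phi *m om - om *m Phi + q%:C%C *: Phi.
  rewrite hQ /Q mulmxBl mul1mx mulmxBr mulmx1 mulmxBl PoP opprB.
  by rewrite [q%:C%C *: _ - _]addrC addrA.
have WE : W = om *m Phi - q%:C%C *: Phi by [].
have trPo : \tr (Phi *m om) = q%:C%C.
  by rewrite -PP -mulmxA mxtrace_mulC PoP mxtraceZ trP mulr1.
have troP : \tr (om *m Phi) = q%:C%C by rewrite mxtrace_mulC.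
have trW : \tr W = 0 by rewrite /W raddfB /= mxtraceZ troP trP mulr1 subrr.
have trW' : \tr (adjmx W) = 0 by rewrite W'E raddfB /= mxtraceZ trPo trP mulr1 subrr.
(* In blocks, [om = Q om Q + W + adjmx W + q Phi]. The square of [b Phi - W] divided by [b] is
   [b Phi - (W + adjmx W) + W (adjmx W) / b], which accounts for the cross terms. *)
clearbody W; exists (Q *m om *m adjmx Q + (b%:C%C)^-1 *: (W *m adjmx W)).
exists ((b%:C%C)^-1 *: ((b%:C%C *: Phi - W) *m adjmx (b%:C%C *: Phi - W))).
have BE : (b%:C%C *: Phi - W) *m adjmx (b%:C%C *: Phi - W) =
    b%:C%C *: (b%:C%C *: Phi) - b%:C%C *: (W + adjmx W) + W *m adjmx W.
  rewrite adjmxB adjmxZ conjC_realc hP mulmxBl !mulmxBr -!scalemxAl -!scalemxAr PP PW' WP.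
  move: (W *m adjmx W) (adjmx W) => M V.
  by apply/matrixP => i j; rewrite !mxE; ring.
have BE' : (b%:C%C)^-1 *: ((b%:C%C *: Phi - W) *m adjmx (b%:C%C *: Phi - W)) =
    b%:C%C *: Phi - (W + adjmx W) + (b%:C%C)^-1 *: (W *m adjmx W).
  by rewrite BE scalerDr scalerBr !scalerA mulVf // mulrA mulVf // scale1r mul1r.
split.
- by apply: psdD; [apply: psd_conj | apply: psdZ => //; apply: psd_gram].
- by apply: psdZ => //; apply: psd_gram.
- rewrite BE' QoQ; move: (W *m adjmx W) => M; rewrite W'E WE rmorphD scalerDl.
  move: (Phi *m om) (om *m Phi) => X Y.
  by apply/matrixP => i j; rewrite !mxE; ring.
- rewrite BE' QoQ !mxtraceD !raddfN /= !mxtraceD !mxtraceZ trW trW' tro trP trPo troP.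
  by set c := \tr _; ring.
Qed.

(** The Choi program state at time zero. *)
Definition maxent d : 'M[C]_(d * d) := (d%:R)^-1 *: choi id.

(** Here [f] is the unnormalised maximally entangled vector; its width [1 * 1] comes from the tensor
    product of two columns. *)
Lemma maxentE d : exists f : 'M[C]_(d * d, 1 * 1),
  choi (@id 'M[C]_d) = f *m adjmx f /\
  forall N : 'M[C]_d, adjmx f *m (1%:M *t N) *m f = (\tr N)%:M.
Proof.
pose e i : 'cV[C]_d := delta_mx i 0.
have adje i : adjmx (e i) = delta_mx 0 i.
  by apply/matrixP => a b; rewrite !mxE andbC; case: andb; rewrite ?conjC0 ?conjC1.
exists (\sum_i (e i *t e i)); split.
  rewrite adjmx_sum mulmx_suml; apply: eq_bigr => i _.
  rewrite mulmx_sumr; apply: eq_bigr => j _.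
  by rewrite adjmx_tens tensmx_mul adje mul_delta_mx.
move=> N; rewrite adjmx_sum mulmx_suml mulmx_suml.
under eq_bigr => i _ do rewrite mulmx_sumr.
have -> : (\tr N)%:M = \sum_i (N i i)%:M :> 'M[C]_(1 * 1) by rewrite /mxtrace raddf_sum.
apply: eq_bigr => i _; rewrite (bigD1 i) //= big1 ?addr0 => [|j ji].
  rewrite adjmx_tens !tensmx_mul mulmx1 adje mul_delta_mx.
  apply/matrixP => a b; rewrite -rowE -colE !mxE.
  by rewrite [a]ord1 [b]ord1 !ord1 !eqxx mul1r.
rewrite adjmx_tens !tensmx_mul mulmx1 adje mul_delta_mx_cond eq_sym (negPf ji).
by rewrite mulr0n tens0mx.
Qed.

(** The threshold of the theorem arises here: the overlap of [Phi] with [om] is [\tr sigma / d ^ 2],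
    one factor [1 / d] coming from each normalisation. *)
Lemma maxent_facts d (sigma : 'M[C]_d) (om := (d%:R)^-1 *: (1%:M *t sigma))
    (Phi := maxent d) : (0 < d)%N -> is_density sigma ->
  [/\ psd om, is_hermitian Phi, Phi *m Phi = Phi,
      Phi *m om *m Phi = ((d ^ 2)%:R^-1)%:C%C *: Phi & \tr om = 1 /\ \tr Phi = 1].
Proof.
move=> d0 [psig trsig]; have [f [fE fN]] := maxentE d.
have dC0 : d%:R != 0 :> C by rewrite pnatr_eq0 -lt0n.
have ff : adjmx f *m f = (d%:R)%:M.
  suff t1 : (1%:M : 'M[C]_d) *t (1%:M : 'M[C]_d) = 1%:M.
    by have := fN 1%:M; rewrite mxtrace1 t1 mulmx1.
  apply/matrixP => a b; case: (mxtens_indexP a) => a1 a2; case: (mxtens_indexP b) => b1 b2.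
  by rewrite tensmxE !mxE (can_eq (@mxtens_indexK _ _)) xpair_eqE -natrM mulnb.
have d1 : (d%:R : C)^-1 ^* = d%:R^-1 by apply/CrealP; rewrite realV realn.
rewrite /om /Phi /maxent fE; split.
- apply: psdZ; first by rewrite invr_ge0.
  by apply: psd_tens => //; have := psd_gram (1%:M : 'M[C]_d); rewrite adjmx1 mulmx1.
- by rewrite /is_hermitian adjmxZ d1 adjmxM adjmxK.
- rewrite -scalemxAl -scalemxAr; congr (_ *: _).
  rewrite mulmxA -(mulmxA f) ff mul_mx_scalar -scalemxAl scalerA mulVf //.
  by rewrite scale1r.
- rewrite -!scalemxAl -!scalemxAr -!scalemxAl !scalerA !mulmxA.
  rewrite -(mulmxA f) -(mulmxA f) fN trsig mulmx1; congr (_ *: _).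
  rewrite rmorphV ?unitfE ?pnatr_eq0 -?lt0n ?expn_gt0 ?d0 //= rmorph_nat natrX.
  by rewrite expr2; field.
split.
  by rewrite mxtraceZ mxtrace_tens trsig mxtrace1 mulr1 mulVf.
by rewrite mxtraceZ mxtrace_mulC ff mxtrace_scalar /= mulr1n mulVf.
Qed.

(** [eigenvalue] provides a row vector [v] with [v *m sigma = lambda *: v], so the projection is
    [adjmx v *m v] divided by the squared norm of [v]. *)
Lemma eigen_projection d (sigma : 'M[C]_d) (lambda : R) :
  eigenvalue sigma lambda%:C%C -> exists E : 'M[C]_d,
  [/\ is_hermitian E, E *m E = E, \tr E = 1 & E *m sigma = lambda%:C%C *: E].
Proof.
move=> /eigenvalueP[v vs v0]; pose n := (v *m adjmx v) 0 0.
have vv : v *m adjmx v = n%:M by rewrite [LHS]mx11_scalar.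
have nE : n = \sum_j `|v 0 j| ^+ 2.
  by rewrite /n mxE; apply: eq_bigr => j _; rewrite mxE normCK.
have n0 : n != 0.
  apply: contraNneq v0 => n0; apply/eqP/rowP => j; rewrite [RHS]mxE.
  have F0 k : 0 <= `|v 0 k| ^+ 2 by apply: exprn_ge0.
  have h := etrans (esym nE) n0.
  have /eqP := psumr_eq0P (fun k _ => F0 k) h (i := j) isT.
  by rewrite expf_eq0 /= normr_eq0 => /eqP.
have nr : (n^-1)^* = n^-1.
  apply/CrealP; rewrite realV; apply: ger0_real.
  by rewrite nE; apply: sumr_ge0 => k _; apply: exprn_ge0.
exists (n^-1 *: (adjmx v *m v)); split.
- by rewrite /is_hermitian adjmxZ adjmxM adjmxK nr.
- rewrite -scalemxAl -scalemxAr; congr (_ *: _).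
  rewrite mulmxA -(mulmxA (adjmx v)) vv mul_mx_scalar -scalemxAl scalerA mulVf //.
  by rewrite scale1r.
- by rewrite mxtraceZ mxtrace_mulC vv mxtrace_scalar mulr1n mulVf.
- by rewrite -scalemxAl -mulmxA vs -scalemxAr !scalerA mulrC.
Qed.

End MaximallyEntangled.

(** * The gap in the programming cost *)

Section ProgrammingCost.
Variable R : realType.
Local Notation C := R[i].

Lemma admissible_norms_gap d m (H : 'M[C]_d) (Ls : 'I_m -> 'M[C]_d)
    (sigma : 'M[C]_d) (lambda : R) (L := gksl H Ls) :
  is_hermitian H -> is_density sigma ->
  (forall rho, is_density rho -> L rho = 0 -> rho = sigma) ->
  eigenvalue sigma lambda%:C%C -> lambda < ((d ^ 2)%:R)^-1 ->
  exists2 g : R, 1 < g & forall T r, 0 < T ->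
    admissible_norms (choi_program L) L T r -> g <= r.
Proof.
move=> hH dsig uniq eig lq.
have d0 : (0 < d)%N.
  case: d H Ls sigma L hH dsig {uniq eig lq} => // H Ls sigma L _ [_ /eqP].
  by rewrite /mxtrace big_ord0 eq_sym oner_eq0.
have kerL := gksl_ker hH uniq.
have trL := gksl_trace H Ls.
have [E [hE EE trE Es]] := eigen_projection eig.
have [pom hP PP PoP [tro trP]] := maxent_facts d0 dsig.
set om := _ *: (1%:M *t sigma) in pom PoP tro; set Phi := maxent R d in hP PP PoP trP.
set q := _^-1 in lq PoP.
have q1 : q <= 1 by rewrite invf_le1 ?ltr0n ?expn_gt0 ?d0 // ler1n expn_gt0 d0.
have q0 : 0 < q by rewrite invr_gt0 ltr0n expn_gt0 d0.
pose W := om *m Phi - q%:C%C *: Phi; pose c := complex.Re (\tr (W *m adjmx W)).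
have tc0 := psd_trace_ge0 (psd_gram W).
have cE : \tr (W *m adjmx W) = c%:C%C by rewrite RRe_real // ger0_real.
have c0 : 0 <= c by rewrite -ler0c -cE.
(* Large enough for the error [2 * c / b] of the decomposition to stay below [q - lambda]. *)
pose b := 1 + 2 * c / (q - lambda).
have ql : 0 < q - lambda by rewrite subr_gt0.
have b1 : 1 <= b by rewrite lerDl divr_ge0 ?mulr_ge0 // ltW.
have b0 : 0 < b by exact: lt_le_trans b1.
have cb : 2 * c / b < q - lambda.
  rewrite ltr_pdivrMr // /b mulrDr mulr1 mulrCA divff ?gt_eqF // mulr1; lra.
have [A [B [pA pB eAB trAB]]] := psd_decomposition pom hP PP PoP tro trP b0.
(* [N] bounds the trace norm of the test operator from above, [D] that of its image from below;
   [D - N = 2 * (q - lambda) - 2 * c / b] is positive. *)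
pose k := b + q; pose N := 1 + k - 2 * q + 2 * c / b; pose D := 1 + k - 2 * lambda.
have cb0 : 0 <= 2 * c / b by rewrite divr_ge0 ?mulr_ge0 // ltW.
have N0 : 0 < N by rewrite /N /k; lra.
exists (D / N); first by rewrite ltr_pdivlMr // mul1r /D /N; lra.
move=> T r T0 [P [lP [hPP [tP [PL ->]]]]].
have [P1 P2] := program_steady trL kerL lP T0 PL.
(* The test operator is [E *t (om - k Phi)]; the two identities of [program_steady] evaluate [P] on
   it. *)
have PE : P (E *t A - E *t B) = sigma - k%:C%C *: E.
  have tensB (Y Z : 'M[C]_(d * d)) : E *t Y - E *t Z = E *t (Y - Z).
    by apply/matrixP => x y; rewrite !mxE mulrBr.
  have tensBZ (Y Z : 'M[C]_(d * d)) a : E *t (Y - a *: Z) = (- a) *: (E *t Z) + E *t Y.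
    by apply/matrixP => x y; rewrite !mxE; ring.
  by rewrite tensB -eAB tensBZ lP P1 P2 trE scale1r scaleNr addrC.
have pE : psd E by have := psd_gram E; rewrite hE EE.
have trDE : \tr (P (E *t A - E *t B)) - 2 * \tr (E *m P (E *t A - E *t B)) = D%:C%C.
  have trB (Y Z : 'M[C]_d) : \tr (Y - Z) = \tr Y - \tr Z by rewrite raddfB.
  rewrite PE mulmxBr Es -scalemxAr EE !trB !mxtraceZ trE dsig.2.
  have DE (x y : R) : (1 + x - 2 * y)%:C%C = 1 + x%:C%C - 2 * y%:C%C :> C.
    by rewrite rmorphB rmorphD rmorphM /= rmorph_nat.
  by rewrite /D DE; ring.
have trNE : \tr (E *t A) + \tr (E *t B) = N%:C%C.
  have NE (x y z : R) : (1 + (x + y) - 2 * y + 2 * z / x)%:C%C =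
      1 + (x%:C%C + y%:C%C) - 2 * y%:C%C + 2 * z%:C%C * (x%:C%C)^-1 :> C.
    by rewrite [LHS]rmorphD rmorphB !rmorphM fmorphV !rmorph_nat !rmorphD.
  by rewrite /N NE !mxtrace_tens trE !mul1r trAB -/W cE; ring.
have hY : is_hermitian (P (E *t A - E *t B)).
  by rewrite PE /is_hermitian adjmxB adjmxZ hE dsig.1.1 conjC_realc.
have n0 : (0 < d * (d * d))%N by rewrite !muln_gt0 d0.
rewrite ler_pdivrMr // mulrC -lecR -trDE.
apply: (diamond_norm_ge lP n0 (psd_tens pE pA) (psd_tens pE pB) hY hE EE N0).
by rewrite trNE.
Qed.

(** A longer horizon puts more constraints on [P]. Monotonicity makes the limit in [prog_cost] exist
    and equal the supremum over all horizons. *)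
Lemma prog_cost_T_nondecreasing d p (pi : R -> 'M[C]_p) (L : 'M[C]_d -> 'M[C]_d) :
  {homo prog_cost_T pi L : s t / s <= t >-> (s <= t)%E}.
Proof.
move=> s t st; apply: ereal_inf_le_tmp => _ [r [P [lP [hP [tP [PL ->]]]]] <-].
exists (diamond_norm P) => //; exists P; do 3 (split => //); split => // u /andP[u0 us] X.
by apply: PL; rewrite u0 (le_trans us).
Qed.

(** The limit being a supremum, a gap at one horizon suffices; if nothing is admissible there, the
    infimum is infinite and the bound still holds. *)
Lemma prog_cost_gt0 d p (pi : R -> 'M[C]_p) (L : 'M[C]_d -> 'M[C]_d) (g T : R) :
  1 < g -> (forall r, admissible_norms pi L T r -> g <= r) -> (0 < prog_cost pi L)%E.
Proof.
move=> g1 gr.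
have /cvg_lim := nondecreasing_cvge (prog_cost_T_nondecreasing pi L).
rewrite /prog_cost => -> //.
have lg : 0 < log2 g by rewrite /log2 divr_gt0 ?ln_gt0 ?ltr1n.
apply: (@lt_le_trans _ _ (log2 g)%:E); first by rewrite lte_fin.
apply: (@le_trans _ _ (prog_cost_T pi L T)); last by apply: ereal_sup_ubound; exists T.
apply: le_ereal_inf_tmp => _ [r /gr gr' <-]; rewrite lee_fin /log2.
rewrite ler_pM2r ?invr_gt0 ?ln_gt0 ?ltr1n // ler_ln ?posrE //.
  exact: lt_trans g1.
exact: lt_le_trans (lt_trans _ g1) gr'.
Qed.

End ProgrammingCost.

Theorem theorem4 (R : realType) (d m : nat) (H : 'M[R[i]]_d)
  (Ls : 'I_m -> 'M[R[i]]_d) (sigma : 'M[R[i]]_d) :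
  is_hermitian H ->
  is_density sigma ->
  (forall rho : 'M[R[i]]_d, is_density rho -> (gksl H Ls rho = 0 <-> rho = sigma)) ->
  (exists lambda : R, eigenvalue sigma (Complex lambda 0) /\ lambda < ((d ^ 2)%:R)^-1) ->
  (0 < gammaL (gksl H Ls))%E.
Proof.
move=> hH dsig steady [lambda [eig lq]].
have uniq rho (drho : is_density rho) := (steady rho drho).1.
have [g g1 gr] := admissible_norms_gap hH dsig uniq eig lq.
(* Any positive horizon would do, since [g] is uniform in it. *)
apply: (prog_cost_gt0 g1 (T := 1)) => r; apply: gr; exact: ltr01.
Qed.
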